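(* There exist a strongly $\mathbb{Z}$-graded ring $R=\bigoplus_{k\in\mathbb{Z}}R_k$ and, with $P=\bigoplus_{k\ge0}R_k$, a bounded complex $C^{+}$ of finitely generated projective $P$-modules such that $C^{+}$ is $R_0$-finitely dominated but $C^{+}$ is not homotopy equivalent (as a complex of $P$-modules) to a bounded complex of finitely generated free $P$-modules.
   Context: All rings are unital (possibly non-commutative), modules are right modules. A $\mathbb{Z}$-graded ring $R$ is strongly graded if the multiplication map $R_n\otimes_{R_0}R_{-n}\to R_0$ is surjective for every $n\in\mathbb{Z}$. A chain complex of $R_0$-modules (a complex of $P$-modules is regarded as one by restriction of scalars) is $R_0$-finitely dominated if it is a retract up to chain homotopy of a bounded complex of finitely generated free $R_0$-modules. *)

(* Defs.v *)
From HB Require Import structures.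
From mathcomp Require Import all_boot all_order all_algebra.
From mathcomp Require Import boolp.

Set Implicit Arguments.
Unset Strict Implicit.
Unset Printing Implicit Defensive.

Import Order.TTheory GRing.Theory Num.Theory.

Local Open Scope ring_scope.

(* Rings are pzRingType's, so the zero ring is allowed.  A left module over the
   opposite ring is a right module: x . a is written (a : A^c) *: x. *)
Notation rmodType A := (lmodType (A : pzRingType)^c).

(* An internal grading: R is the direct sum of the homog G k, k in int. *)
Record zgrading (R : pzRingType) := ZGrading {
  homog :> int -> {pred R};
  homog_zmod : forall k, zmod_closed (homog k);
  homog1 : 1 \in homog 0;
  homogM : forall k l x y, x \in homog k -> y \in homog l ->
    x * y \in homog (k + l);
  homog_span : forall x, exists2 s : seq (int * R),
    all (fun p => p.2 \in homog p.1) s & x = \sum_(p <- s) p.2;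
  homog_indep : forall (s : seq int) (f : int -> R),
    uniq s -> (forall k, f k \in homog k) ->
    \sum_(k <- s) f k = 0 -> forall k, k \in s -> f k = 0
}.

(* The image of a multiplication map out of a tensor product consists of the
   finite sums of products, so this is surjectivity of R_n (x) R_{-n} -> R_0. *)
Definition strongly_graded (R : pzRingType) (G : zgrading R) : Prop :=
  forall (n : int) (r : R), r \in G 0 ->
    exists2 s : seq (R * R),
      all (fun p => (p.1 \in G n) && (p.2 \in G (- n))) s
      & r = \sum_(p <- s) p.1 * p.2.

Section Subrings.
Variables (R : pzRingType) (G : zgrading R).

Definition deg0_pred : {pred R} := G 0.

Lemma deg0_closed : subring_closed deg0_pred.
Proof.
split; first exact: homog1.
- by case: (homog_zmod G 0) => _; apply.
- by move=> x y x0 y0; have := homogM x0 y0; rewrite addr0.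
Qed.

Record deg0 := Deg0 { deg0_val :> R; _ : deg0_val \in deg0_pred }.

HB.instance Definition _ := [isSub for deg0_val].
HB.instance Definition _ := [Choice of deg0 by <:].
HB.instance Definition _ :=
  GRing.SubChoice_isSubPzRing.Build R deg0_pred deg0 deg0_closed.

Definition nneg_sum (x : R) : Prop :=
  exists2 s : seq (int * R),
    all (fun p => (0 <= p.1) && (p.2 \in G p.1)) s & x = \sum_(p <- s) p.2.

Definition nneg_pred : {pred R} := fun x => `[< nneg_sum x >].

Lemma nneg_closed : subring_closed nneg_pred.
Proof.
split.
- by apply/asboolP; exists [:: (0, 1)]; rewrite ?big_seq1 //= homog1.
- move=> x y /asboolP[s /allP sG ->] /asboolP[t /allP tG ->]; apply/asboolP.
  exists (s ++ [seq (p.1, - p.2) | p <- t]); last first.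
    by rewrite big_cat /= big_map /= sumrN.
  rewrite all_cat; apply/andP; split; first exact/allP.
  apply/allP => _ /mapP[p /tG /andP[p0 pG] ->] /=; rewrite p0 /=.
  by case: (homog_zmod G p.1) => z0 zB; rewrite -sub0r; apply: zB.
- move=> x y /asboolP[s /allP sG ->] /asboolP[t /allP tG ->]; apply/asboolP.
  exists [seq (p.1 + q.1, p.2 * q.2) | p <- s, q <- t]; last first.
    rewrite big_allpairs_dep /= mulr_suml; apply: eq_bigr => p _.
    by rewrite mulr_sumr.
  apply/allP => _ /allpairsP[[p q] /= [/sG /andP[p0 pG] /tG /andP[q0 qG] ->]] /=.
  by rewrite addr_ge0 //= homogM.
Qed.

(* P, the subring of the finite sums of elements of degree >= 0 *)
Record nneg := Nneg { nneg_val :> R; _ : nneg_val \in nneg_pred }.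

HB.instance Definition _ := [isSub for nneg_val].
HB.instance Definition _ := [Choice of nneg by <:].
HB.instance Definition _ :=
  GRing.SubChoice_isSubPzRing.Build R nneg_pred nneg nneg_closed.

Lemma deg0_nneg (x : deg0) : val x \in nneg_pred.
Proof.
by apply/asboolP; exists [:: (0, val x)]; rewrite ?big_seq1 //= (valP x).
Qed.

Definition deg0_incl (x : deg0) : nneg := Nneg (deg0_nneg x).

Lemma deg0_incl_is_zmod : zmod_morphism deg0_incl.
Proof. by move=> x y; apply: val_inj; rewrite [RHS]rmorphB; apply: rmorphB. Qed.

Lemma deg0_incl_is_monoid : monoid_morphism deg0_incl.
Proof.
split=> [|x y]; apply: val_inj; first by rewrite [RHS]rmorph1; apply: rmorph1.
by rewrite [RHS]rmorphM; apply: rmorphM.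
Qed.

HB.instance Definition _ :=
  GRing.isZmodMorphism.Build deg0 nneg deg0_incl deg0_incl_is_zmod.
HB.instance Definition _ :=
  GRing.isMonoidMorphism.Build deg0 nneg deg0_incl deg0_incl_is_monoid.

End Subrings.

Section Modules.
Variable A : pzRingType.

Definition finitely_generated (M : rmodType A) : Prop :=
  exists (n : nat) (e : 'I_n -> M),
    forall x, exists a : 'I_n -> A^c, x = \sum_(i < n) a i *: e i.

Definition projective (M : rmodType A) : Prop :=
  forall (N N' : rmodType A) (g : {linear N -> N'}) (f : {linear M -> N'}),
    (forall y, exists x, g x = y) ->
    exists f' : {linear M -> N}, forall x, g (f' x) = f x.

Definition fg_projective (M : rmodType A) : Prop :=
  finitely_generated M /\ projective M.

Definition fg_free (M : rmodType A) : Prop :=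
  exists (n : nat) (f : {linear 'rV[A^c]_n -> M}), bijective f.

End Modules.

(* The differential ch_d C n goes from degree n + 1 to degree n. *)
Record complex (A : pzRingType) := Complex {
  ch_obj :> int -> rmodType A;
  ch_d : forall n : int, {linear ch_obj (n + 1) -> ch_obj n};
  ch_dd : forall (n : int) (x : ch_obj (n + 1 + 1)), ch_d n (ch_d (n + 1) x) = 0
}.

Section Complexes.
Variable A : pzRingType.

Definition bounded (C : complex A) : Prop :=
  exists a b : int, forall n : int, (n < a) || (b < n) -> forall x : C n, x = 0.

Record chain_map (C D : complex A) := ChainMap {
  cm_fun :> forall n : int, {linear C n -> D n};
  cm_comm : forall (n : int) (x : C (n + 1)),
    cm_fun n (ch_d C n x) = ch_d D n (cm_fun (n + 1) x)
}.

(* The family u n v n is that of the composite of the chain maps v and u; the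
   homotopy identity is written in degree n + 1, which reaches every degree. *)
Definition comp_homotopic_id (C D : complex A)
    (v : chain_map C D) (u : chain_map D C) : Prop :=
  exists h : forall n : int, {linear C n -> C (n + 1)},
    forall (n : int) (x : C (n + 1)),
      u (n + 1) (v (n + 1) x) - x
      = ch_d C (n + 1) (h (n + 1) x) + h n (ch_d C n x).

Definition homotopy_equivalent (C D : complex A) : Prop :=
  exists (f : chain_map C D) (g : chain_map D C),
    comp_homotopic_id f g /\ comp_homotopic_id g f.

Definition homotopy_retract (C D : complex A) : Prop :=
  exists (s : chain_map C D) (r : chain_map D C), comp_homotopic_id s r.

Definition finitely_dominated (C : complex A) : Prop :=
  exists D : complex A,
    [/\ bounded D, forall n, fg_free (D n) & homotopy_retract C D].

End Complexes.

(* restr phi M is an alias of M; the phantom argument phi determines the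
   A-module structure put on it. *)
Definition restr (A B : pzRingType) (_ : {rmorphism A -> B}) (M : rmodType B) :
  Type := M.

Section Restriction.
Variables (A B : pzRingType) (phi : {rmorphism A -> B}).

Section Module.
Variable M : rmodType B.

HB.instance Definition _ := GRing.Zmodule.copy (restr phi M) M.

Definition restr_scale (a : A^c) (x : restr phi M) : restr phi M :=
  (phi a : B^c) *: (x : M).

Lemma restr_scaleA a b x :
  restr_scale a (restr_scale b x) = restr_scale (a * b) x.
Proof. by rewrite /restr_scale scalerA; congr (_ *: _); apply/esym/(rmorphM phi b a). Qed.

Lemma restr_scale1 : left_id 1 restr_scale.
Proof. by move=> x; rewrite /restr_scale (rmorph1 phi) scale1r. Qed.

Lemma restr_scaleDr : right_distributive restr_scale +%R.
Proof. by move=> a x y; rewrite /restr_scale scalerDr. Qed.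

Lemma restr_scaleDl x : {morph restr_scale^~ x : a b / a + b}.
Proof. by move=> a b; rewrite /restr_scale (rmorphD phi) scalerDl. Qed.

HB.instance Definition _ := GRing.Zmodule_isLmodule.Build A^c (restr phi M)
  restr_scaleA restr_scale1 restr_scaleDr restr_scaleDl.

End Module.

Section Map.
Variables (M N : rmodType B) (f : {linear M -> N}).

Definition restr_map (x : restr phi M) : restr phi N := f x.

Lemma restr_map_linear : linear restr_map.
Proof. by move=> a x y; rewrite /restr_map linearP. Qed.

HB.instance Definition _ :=
  GRing.isLinear.Build A^c (restr phi M) (restr phi N) _ restr_map restr_map_linear.

End Map.

Definition restr_complex (C : complex B) : complex A :=
  @Complex A (fun n => restr phi (C n)) (fun n => restr_map (ch_d C n))
    (@ch_dd B C).

End Restriction.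

(* Main.v *)
(** Let [K] be a commutative ring and [R] the ring of operators on [int -> K]
    that are finite sums of operators [v |-> (i |-> a i * v (i + k))], the
    latter being homogeneous of degree [k].  The elements of [P] are the upper
    triangular operators, with matrix units [munit p q] for [p <= q], and left
    multiplication by [munit 0 1] is an injection of right [P]-modules
      munit 1 1 * P -> munit 0 0 * P.
    Its cokernel is the right ideal of [R_0] generated by [munit 0 0], so that
    this two-term complex is dominated by [R_0] in degree 0.

    Each diagonal entry is a ring morphism [P -> K], so it yields a trace on
    endomorphisms of finitely generated projective modules and an Euler
    characteristic that is invariant under homotopy.  For a complex of free
    modules it does not depend on the chosen entry; for the two-term complex
    it is 1 at the entry 0 and 0 at the entry 2. *)

From HB Require Import structures.
Require Import Defs.
From mathcomp Require Import all_boot all_order all_algebra.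
From mathcomp Require Import boolp zify.

Set Implicit Arguments.
Unset Strict Implicit.
Unset Printing Implicit Defensive.

Import Order.TTheory GRing.Theory Num.Theory.

Local Open Scope ring_scope.

(** * Traces and Euler characteristics *)

Section FreeRetract.
Variable A : pzRingType.

(** A witness of finitely generated projectivity kept as data, so that traces can be computed from
    it. *)
Record free_retract (M : rmodType A) := FreeRetract {
  rk : nat;
  fr_in : {linear M -> 'rV[A^c]_rk};
  fr_out : {linear 'rV[A^c]_rk -> M};
  fr_inK : cancel fr_in fr_out
}.

Lemma linear_row_sum (M : rmodType A) n (f : {linear 'rV[A^c]_n -> M}) x :
  f x = \sum_(i < n) x 0 i *: f (delta_mx 0 i).
Proof.
by rewrite {1}[x]row_sum_delta linear_sum; apply: eq_bigr => i _; rewrite linearZ.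
Qed.

Lemma free_retract_fg_projective (M : rmodType A) :
  free_retract M -> fg_projective M.
Proof.
case=> n s r sK; split.
  exists n, (fun i => r (delta_mx 0 i)) => x; exists (s x 0).
  by rewrite -linear_row_sum sK.
move=> N N' g f g_surj.
have /choice[y yE] (i : 'I_n) : exists y, g y = f (r (delta_mx 0 i)).
  exact: g_surj.
(* Lift the images of the basis vectors and extend by the coordinates of [s x]. *)
pose lift_f x := \sum_(i < n) s x 0 i *: y i.
have lift_f_linear : linear lift_f.
  move=> a u v; rewrite /lift_f scaler_sumr -big_split; apply: eq_bigr => i _.
  by rewrite /= linearP !mxE scalerDl scalerA.
exists (HB.pack_for {linear M -> N} lift_f
  (GRing.isLinear.Build _ _ _ _ lift_f lift_f_linear)) => x /=.
rewrite linear_sum -[in RHS](sK x) linear_row_sum linear_sum.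
by apply: eq_bigr => i _; rewrite !linearZ yE.
Qed.

Section Trace.
Variables (K : comPzRingType) (eps : {rmorphism A -> K}).

(** For linear [f] this is the Hattori-Stallings trace pushed forward along [eps]. Taking [f] as a
    bare function lets composites, sums and differences be written without bundling linearity. *)
Definition fr_trace (M : rmodType A) (b : free_retract M) (f : M -> M) : K :=
  \sum_(i < rk b) eps (fr_in b (f (fr_out b (delta_mx 0 i))) 0 i).

(** Inserting the retraction of the other module between [f] and [g] turns each side into the same
    double sum of products of matrix coefficients; commutativity of [K] absorbs the order of the
    factors. *)
Lemma fr_traceC (M N : rmodType A) (b : free_retract M) (c : free_retract N)
    (f : {linear M -> N}) (g : {linear N -> M}) :
  fr_trace c (fun x => f (g x)) = fr_trace b (fun x => g (f x)).
Proof.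
pose F i j := fr_in c (f (fr_out b (delta_mx 0 i))) 0 j : A.
pose H j i := fr_in b (g (fr_out c (delta_mx 0 j))) 0 i : A.
transitivity (\sum_j \sum_i eps (F i j) * eps (H j i)).
  apply: eq_bigr => j _.
  rewrite -[g _](fr_inK b) linear_row_sum !linear_sum summxE rmorph_sum.
  by apply: eq_bigr => i _; rewrite !linearZ mxE -rmorphM.
rewrite exchange_big; apply: eq_bigr => i _.
rewrite -[f _](fr_inK c) linear_row_sum !linear_sum summxE rmorph_sum.
by apply: eq_bigr => j _; rewrite !linearZ mxE mulrC -rmorphM.
Qed.

Lemma eq_fr_trace (M : rmodType A) (b : free_retract M) (f g : M -> M) :
  f =1 g -> fr_trace b f = fr_trace b g.
Proof. by move=> fg; apply: eq_bigr => i _; rewrite fg. Qed.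

Lemma fr_traceD (M : rmodType A) (b : free_retract M) (f g : M -> M) :
  fr_trace b (fun x => f x + g x) = fr_trace b f + fr_trace b g.
Proof.
by rewrite -big_split; apply: eq_bigr => i _; rewrite linearD mxE rmorphD.
Qed.

Lemma fr_traceB (M : rmodType A) (b : free_retract M) (f g : M -> M) :
  fr_trace b (fun x => f x - g x) = fr_trace b f - fr_trace b g.
Proof.
by rewrite -sumrB; apply: eq_bigr => i _; rewrite linearB !mxE rmorphB.
Qed.

Lemma fr_trace_trivial (M : rmodType A) (b : free_retract M) (f : M -> M) :
  (forall x : M, x = 0) -> fr_trace b f = 0.
Proof.
by move=> M0; apply: big1 => i _; rewrite (M0 (f _)) linear0 mxE rmorph0.
Qed.

End Trace.

(** For free modules the trace of the identity is a rank, the same for every [eps]. This is the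
    property that the two-term complex will violate. *)
Lemma fg_free_retract (M : rmodType A) : fg_free M ->
  exists b : free_retract M, forall (K : comPzRingType) (eps : {rmorphism A -> K}),
    fr_trace eps b id = (rk b)%:R.
Proof.
case=> n [f [g fK gK]].
have g_linear : linear g by apply: can2_linear fK gK.
pose g' := HB.pack_for {linear M -> 'rV[A^c]_n} g
  (GRing.isLinear.Build _ _ _ _ g g_linear).
have gK' : cancel g' f by [].
exists (FreeRetract gK') => K eps; rewrite /fr_trace /=.
rewrite (eq_bigr (fun=> 1)) ?sumr_const ?card_ord // => i _.
by rewrite fK mxE !eqxx (rmorph1 eps).
Qed.

Section EulerCharacteristic.
Variables (K : comPzRingType) (eps : {rmorphism A -> K}).
(* By cyclicity of the trace, the two terms [d h] and [h d] of a homotopy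
   contribute the same scalar [u n] in the adjacent degrees [n] and [n + 1]. *)
Lemma trace_comp_homotopic_id (C D : complex A)
    (b : forall n, free_retract (C n)) (v : chain_map C D) (w : chain_map D C) :
  comp_homotopic_id v w ->
  exists u : int -> K,
    (forall n, (forall x : C n, x = 0) -> u n = 0) /\
    forall n, fr_trace eps (b (n + 1)) (fun x => w _ (v _ x))
      - fr_trace eps (b (n + 1)) id = u (n + 1) + u n.
Proof.
case=> h hE; exists (fun n => fr_trace eps (b n) (fun x => ch_d C n (h n x))).
split=> [n|n]; first exact: fr_trace_trivial.
rewrite -fr_traceB (eq_fr_trace _ _ (hE n)) fr_traceD; congr (_ + _).
exact: fr_traceC.
Qed.

Variables (C D : complex A).
Variables (b : forall n, free_retract (C n)) (c : forall n, free_retract (D n)).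

(** The sum runs over the degrees [a + 1] to [a + N]. The homotopies change it by a telescoping sum,
    whose boundary terms sit in degrees [a] and [a + N], where both complexes vanish. *)
Lemma euler_homotopy_equivalent (a : int) (N : nat) :
  homotopy_equivalent C D ->
  (forall x : C a, x = 0) -> (forall x : D a, x = 0) ->
  (forall x : C (a + N%:Z), x = 0) -> (forall x : D (a + N%:Z), x = 0) ->
  \sum_(k < N) (-1) ^+ k * fr_trace eps (b (a + k%:Z + 1)) id
  = \sum_(k < N) (-1) ^+ k * fr_trace eps (c (a + k%:Z + 1)) id.
Proof.
case=> f [g [fg gf]] Ca Da CN DN.
have [u [u0 uE]] := trace_comp_homotopic_id b fg.
have [u' [u'0 u'E]] := trace_comp_homotopic_id c gf.
apply/eqP; rewrite -subr_eq0 -sumrB.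
(* By [fr_traceC] the composites [g f] and [f g] have equal traces, so the identity traces differ
   only by the homotopy terms. *)
pose w n := u' n - u n.
have step k : fr_trace eps (b (a + k%:Z + 1)) id
    - fr_trace eps (c (a + k%:Z + 1)) id = w (a + k.+1%:Z) + w (a + k%:Z).
  have -> : a + k.+1%:Z = a + k%:Z + 1 by rewrite -addn1 PoszD addrA.
  rewrite /w addrACA -opprD -u'E -uE.
  rewrite (fr_traceC eps (b (a + k%:Z + 1)) (c (a + k%:Z + 1))).
  by rewrite opprB [RHS]addrC addrA subrK.
rewrite (eq_bigr (fun k : 'I_N =>
    - ((-1) ^+ k.+1 * w (a + k.+1%:Z) - (-1) ^+ k * w (a + k%:Z)))); last first.
  by move=> k _; rewrite -mulrBr step exprS mulN1r mulNr opprB opprK mulrDr addrC.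
pose F k := (-1) ^+ k * w (a + k%:Z).
rewrite sumrN -(big_mkord xpredT (fun k => F k.+1 - F k)) telescope_sumr // /F.
by rewrite addr0 /w !(u0, u'0) // subrr !mulr0 subrr oppr0.
Qed.

End EulerCharacteristic.
End FreeRetract.

(** * Right ideals generated by idempotents *)

Section RightIdeal.
Variables (A : pzRingType) (e : A).

(** For idempotent [e] the fixed points of left multiplication by [e] are the right ideal [e A];
    this form makes membership a decidable equation. The regular module of [A^c] is [A] as a right
    module over itself. *)
Definition ideal_pred : {pred (A^c)^o} := fun x => e * (x : A) == x.

Lemma ideal_closed : subsemimod_closed ideal_pred.
Proof.
split; last first.
  by move=> a x /eqP ex; apply/eqP; rewrite -[in RHS]ex; apply: (mulrA e (x : A)).
split=> [|x y /eqP ex /eqP ey]; first by apply/eqP/mulr0.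
by apply/eqP; rewrite -[in RHS]ex -[in RHS]ey; apply: mulrDr.
Qed.

Record ideal := Ideal { ideal_val : A; _ : ideal_val \in ideal_pred }.

HB.instance Definition _ := [isSub for ideal_val].
HB.instance Definition _ := [Choice of ideal by <:].
HB.instance Definition _ :=
  GRing.SubChoice_isSubLmodule.Build A^c (A^c)^o ideal_pred ideal ideal_closed.

Lemma idealP (x : ideal) : e * ideal_val x = ideal_val x.
Proof. exact/eqP/(valP x). Qed.

Lemma ideal_eq (x y : ideal) : ideal_val x = ideal_val y -> x = y.
Proof. exact: val_inj. Qed.

Lemma ideal0E : ideal_val 0 = 0. Proof. exact: (raddf0 (val : ideal -> (A^c)^o)). Qed.
Lemma idealDE x y : ideal_val (x + y) = ideal_val x + ideal_val y.
Proof. exact: (raddfD (val : ideal -> (A^c)^o)). Qed.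
Lemma idealZE (a : A^c) (x : ideal) : ideal_val (a *: x) = ideal_val x * (a : A).
Proof. by []. Qed.

Definition ideal_in (x : ideal) : 'rV[A^c]_1 := const_mx (ideal_val x).

Lemma ideal_in_linear : linear ideal_in.
Proof.
move=> a x y; apply/rowP => i; rewrite !mxE idealDE.
by congr (_ + _); apply: idealZE.
Qed.
HB.instance Definition _ :=
  GRing.isLinear.Build _ _ _ _ ideal_in ideal_in_linear.

End RightIdeal.

Section IdealMaps.
Variable A : pzRingType.

Fact ideal_mul_subproof (e f d : A) (x : ideal e) :
  f * d = d -> d * ideal_val x \in ideal_pred f.
Proof. by move=> fd; apply/eqP; rewrite mulrA fd. Qed.

Definition ideal_mul (e f d : A) (fd : f * d = d) (x : ideal e) : ideal f :=
  Ideal (ideal_mul_subproof x fd).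

Lemma ideal_mul_linear e f d fd : linear (@ideal_mul e f d fd).
Proof.
move=> a x y; apply: ideal_eq; rewrite idealDE idealZE.
by rewrite -[LHS]/(d * ideal_val (a *: x + y)) idealDE idealZE mulrDr mulrA.
Qed.
HB.instance Definition _ e f d fd :=
  GRing.isLinear.Build A^c _ _ _ (@ideal_mul e f d fd) (@ideal_mul_linear e f d fd).

Variables (e : A) (ee : e * e = e).

Fact ideal_out_subproof (x : 'rV[A^c]_1) : e * (x 0 0 : A) \in ideal_pred e.
Proof. by apply/eqP; rewrite mulrA ee. Qed.
Definition ideal_out x := Ideal (ideal_out_subproof x).

Lemma ideal_out_linear : linear ideal_out.
Proof.
move=> a x y; apply: ideal_eq; rewrite idealDE idealZE /= !mxE mulrDr.
by congr (_ + _); apply: (mulrA e (x 0 0 : A) (a : A)).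
Qed.
HB.instance Definition _ :=
  GRing.isLinear.Build _ _ _ _ ideal_out ideal_out_linear.

Lemma ideal_inK : cancel (@ideal_in A e) ideal_out.
Proof. by move=> x; apply: ideal_eq; rewrite /= mxE idealP. Qed.

Definition ideal_retract : free_retract (ideal e) :=
  @FreeRetract _ (ideal e : rmodType A) 1 (@ideal_in A e) ideal_out ideal_inK.

Lemma trace_ideal (K : comPzRingType) (eps : {rmorphism A -> K}) :
  fr_trace eps ideal_retract id = eps e.
Proof.
rewrite /fr_trace big_ord1 /= !mxE /ideal_out /=; congr (eps _).
by rewrite !mxE; apply: (mulr1 e).
Qed.

End IdealMaps.

Section IdealComplex.
Variables (A : pzRingType) (e d : int -> A).
Hypotheses (ed : forall n, e n * d n = d n) (dd : forall n, d n * d (n + 1) = 0).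

Lemma ideal_complex_dd n (x : ideal (e (n + 1 + 1))) :
  ideal_mul (ed n) (ideal_mul (ed (n + 1)) x) = 0.
Proof. by apply: ideal_eq; rewrite ideal0E /= mulrA dd mul0r. Qed.

Definition ideal_complex : complex A :=
  @Complex A (fun n => ideal (e n)) (fun n => @ideal_mul A _ _ _ (ed n))
    ideal_complex_dd.

End IdealComplex.

(** * The graded ring of band operators *)

Section BandOperators.
Variable K : comNzRingType.

Definition band_fun (s : seq (int * (int -> K))) (v : int -> K) (i : int) : K :=
  \sum_(p <- s) p.2 i * v (i + p.1).

(** A presentation as a finite sum is not unique, so it is only asserted to exist; equality of band
    operators is then equality of functions. *)
Record band := Band {
  band_op :> (int -> K) -> int -> K;
  band_opP : exists s, forall v i, band_op v i = band_fun s v i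
}.

HB.instance Definition _ := gen_eqMixin band.
HB.instance Definition _ := gen_choiceMixin band.

Implicit Types (S T U : band) (v w : int -> K) (i k l n : int).

Lemma bandP S T : (forall v i, S v i = T v i) -> S = T.
Proof.
case: S T => [f fP] [g gP] /= fg.
have {}fg : f = g by apply/funext => v; apply/funext => i; apply: fg.
by case: _ / fg in gP *; congr Band; apply: Prop_irrelevance.
Qed.

Fact mono_subproof k (a : int -> K) :
  exists s, forall v i, (fun v i => a i * v (i + k)) v i = band_fun s v i.
Proof. by exists [:: (k, a)] => v i; rewrite /band_fun big_seq1. Qed.
Definition mono k a := Band (mono_subproof k a).

Fact band_zero_subproof :
  exists s, forall v i, (fun _ _ => 0 : K) v i = band_fun s v i.
Proof. by exists [::] => v i; rewrite /band_fun big_nil. Qed.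
Definition band_zero := Band band_zero_subproof.

Fact band_opp_subproof S :
  exists s, forall v i, (fun v i => - S v i) v i = band_fun s v i.
Proof.
have [s Ss] := band_opP S; exists [seq (p.1, fun i => - p.2 i) | p <- s] => v i.
by rewrite Ss /band_fun big_map -sumrN; apply: eq_bigr => p _; rewrite mulNr.
Qed.
Definition band_opp S := Band (band_opp_subproof S).

Fact band_add_subproof S T :
  exists s, forall v i, (fun v i => S v i + T v i) v i = band_fun s v i.
Proof.
have [s Ss] := band_opP S; have [t Tt] := band_opP T.
by exists (s ++ t) => v i; rewrite Ss Tt /band_fun big_cat.
Qed.
Definition band_add S T := Band (band_add_subproof S T).

Fact band_mul_subproof S T :
  exists s, forall v i, (fun v i => S (T v) i) v i = band_fun s v i.
Proof.
have [s Ss] := band_opP S; have [t Tt] := band_opP T.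
exists [seq (p.1 + q.1, fun i => p.2 i * q.2 (i + p.1)) | p <- s, q <- t] => v i.
rewrite Ss /band_fun big_allpairs_dep /=; apply: eq_bigr => p _.
rewrite Tt /band_fun mulr_sumr; apply: eq_bigr => q _.
by rewrite mulrA addrA.
Qed.
Definition band_mul S T := Band (band_mul_subproof S T).

Definition band_one := mono 0 (fun=> 1).

Lemma band_opD S v w i : S (fun j => v j + w j) i = S v i + S w i.
Proof.
have [s Ss] := band_opP S; rewrite !Ss -big_split.
by apply: eq_bigr => p _; rewrite mulrDr.
Qed.

Lemma band_opZ S (c : K) v i : S (fun j => c * v j) i = c * S v i.
Proof.
have [s Ss] := band_opP S; rewrite !Ss mulr_sumr.
by apply: eq_bigr => p _; rewrite mulrCA.
Qed.

Lemma band_ext S v w i : v =1 w -> S v i = S w i.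
Proof. by move/funext->. Qed.

Fact band_addA : associative band_add.
Proof. by move=> S T U; apply: bandP => v i; apply: addrA. Qed.
Fact band_addC : commutative band_add.
Proof. by move=> S T; apply: bandP => v i; apply: addrC. Qed.
Fact band_add0 : left_id band_zero band_add.
Proof. by move=> S; apply: bandP => v i; apply: add0r. Qed.
Fact band_addN : left_inverse band_zero band_opp band_add.
Proof. by move=> S; apply: bandP => v i; apply: addNr. Qed.
Fact band_mulA : associative band_mul.
Proof. by move=> S T U; apply: bandP => v i. Qed.
Fact band_mul1 : left_id band_one band_mul.
Proof. by move=> S; apply: bandP => v i; rewrite /= mul1r addr0. Qed.
Fact band_mulr1 : right_id band_one band_mul.
Proof.
by move=> S; apply: bandP => v i /=; apply: band_ext => j; rewrite mul1r addr0.
Qed.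
Fact band_mulDl : left_distributive band_mul band_add.
Proof. by move=> S T U; apply: bandP => v i. Qed.
Fact band_mulDr : right_distributive band_mul band_add.
Proof. by move=> S T U; apply: bandP => v i; apply: band_opD. Qed.

HB.instance Definition _ := GRing.isPzRing.Build band
  band_addA band_addC band_add0 band_addN band_mulA band_mul1 band_mulr1
  band_mulDl band_mulDr.

Lemma band0E v i : (0 : band) v i = 0. Proof. by []. Qed.
Lemma bandNE S v i : (- S) v i = - S v i. Proof. by []. Qed.
Lemma bandDE S T v i : (S + T) v i = S v i + T v i. Proof. by []. Qed.
Lemma bandME S T v i : (S * T) v i = S (T v) i. Proof. by []. Qed.

Lemma band_sumE (I : Type) (r : seq I) (F : I -> band) v i :
  (\sum_(j <- r) F j) v i = \sum_(j <- r) F j v i.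
Proof.
by elim: r => [|j r IHr]; rewrite ?big_nil // !big_cons bandDE IHr.
Qed.

(** * The strong grading of the band operators *)

Definition band_homog k : {pred band} :=
  fun S => `[< exists a : int -> K, S = mono k a >].

Lemma mono_homog k a : mono k a \in band_homog k.
Proof. by apply/asboolP; exists a. Qed.

Lemma band_homog_zmod k : zmod_closed (band_homog k).
Proof.
split.
  by apply/asboolP; exists (fun=> 0); apply: bandP => v i; rewrite /= mul0r.
move=> _ _ /asboolP[a ->] /asboolP[b ->].
apply/asboolP; exists (fun i => a i - b i); apply: bandP => v i.
by rewrite bandDE bandNE /= mulrBl.
Qed.

Lemma band_homog1 : 1 \in band_homog 0.
Proof. exact: mono_homog. Qed.

Lemma band_homogM k l S T :
  S \in band_homog k -> T \in band_homog l -> S * T \in band_homog (k + l).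
Proof.
move=> /asboolP[a ->] /asboolP[b ->].
apply/asboolP; exists (fun i => a i * b (i + k)); apply: bandP => v i.
by rewrite bandME /= mulrA addrA.
Qed.

Lemma band_fun_sum s S : (forall v i, S v i = band_fun s v i) ->
  S = \sum_(p <- s) mono p.1 p.2.
Proof. by move=> Ss; apply: bandP => v i; rewrite band_sumE Ss. Qed.

Lemma band_homog_span S : exists2 s : seq (int * band),
  all (fun p => p.2 \in band_homog p.1) s & S = \sum_(p <- s) p.2.
Proof.
have [s /band_fun_sum ->] := band_opP S.
exists [seq (p.1, mono p.1 p.2) | p <- s]; last by rewrite big_map.
by apply/allP => _ /mapP[p _ ->]; apply: mono_homog.
Qed.

Definition delta (p : int) : int -> K := fun j => (j == p)%:R.

Lemma band_homog_indep (s : seq int) (f : int -> band) :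
  uniq s -> (forall k, f k \in band_homog k) ->
  \sum_(k <- s) f k = 0 -> forall k, k \in s -> f k = 0.
Proof.
move=> s_uniq fH sum0 k ks.
have /choice[a fa] l : exists a, f l = mono l a by apply/asboolP/fH.
rewrite fa; apply: bandP => v i; rewrite band0E /=.
suff -> : a k i = 0 by rewrite mul0r.
(* Row [i] of the sum, applied to the basis vector at [i + k], isolates the coefficient [a k i]. *)
have /(congr1 (fun S : band => S (delta (i + k)) i)) := sum0.
rewrite band_sumE (bigD1_seq k) //= fa /= /delta eqxx mulr1 big1 ?addr0 //.
by move=> l lk; rewrite fa /= (inj_eq (addrI i)) (negPf lk) mulr0.
Qed.

Definition band_grading : zgrading band :=
  ZGrading band_homog_zmod band_homog1 band_homogM band_homog_span
    band_homog_indep.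

Lemma band_strongly_graded : strongly_graded band_grading.
Proof.
(* The shift of degree [n] is invertible with inverse of degree [- n], so a single product
   suffices. *)
move=> n r r0; exists [:: (mono n (fun=> 1), mono (- n) (fun=> 1) * r)].
  rewrite /= andbT; apply/andP; split; first exact: mono_homog.
  by have := band_homogM (mono_homog (- n) (fun=> 1)) r0; rewrite addr0.
rewrite big_seq1 mulrA -[LHS]mul1r; congr (_ * _); apply: bandP => v i.
by rewrite bandME /= !mul1r addrK addr0.
Qed.

(* Restricting [v] to [[i, +oo)] before evaluating at [i] discards exactly the
   components of negative degree. *)
Fact trunc_subproof S : exists s, forall v i,
  (fun v i => S (fun j => (i <= j)%R%:R * v j) i) v i = band_fun s v i.
Proof.
have [s Ss] := band_opP S; exists [seq p <- s | 0 <= p.1] => v i.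
rewrite Ss /band_fun big_filter [RHS]big_mkcond; apply: eq_bigr => p _.
by rewrite lerDl; case: ifP; rewrite ?mul1r // mul0r mulr0.
Qed.
Definition trunc S := Band (trunc_subproof S).

Lemma truncD S T : trunc (S + T) = trunc S + trunc T.
Proof. exact: bandP. Qed.

Lemma trunc0 : trunc 0 = 0.
Proof. exact: bandP. Qed.

Definition in_nneg S := S \in nneg_pred band_grading.

Lemma homog_nneg k S : 0 <= k -> S \in band_homog k -> in_nneg S.
Proof.
by move=> k0 Sk; apply/asboolP; exists [:: (k, S)]; rewrite ?big_seq1 //= k0 Sk.
Qed.

Lemma nneg_sum_ind (Q : band -> Prop) S :
  in_nneg S -> Q 0 -> (forall S T, Q S -> Q T -> Q (S + T)) ->
  (forall k a, 0 <= k -> Q (mono k a)) -> Q S.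
Proof.
move=> /asboolP[s /allP sP ->] Q0 QD Qm; rewrite big_seq.
apply: big_ind => // p /sP /andP[p0 /asboolP[a ->]]; exact: Qm.
Qed.

Lemma in_nneg0 : in_nneg 0.
Proof. by apply/asboolP; exists [::]; rewrite ?big_nil. Qed.

Lemma in_nnegD S T : in_nneg S -> in_nneg T -> in_nneg (S + T).
Proof.
move=> /asboolP[s sP ->] /asboolP[t tP ->]; apply/asboolP; exists (s ++ t).
  by rewrite all_cat sP tP.
by rewrite big_cat.
Qed.

Lemma trunc_mono k a : trunc (mono k a) = if 0 <= k then mono k a else 0.
Proof.
apply: bandP => v i; rewrite /= lerDl.
by case: (0 <= k); rewrite ?mul1r // mul0r mulr0.
Qed.

(** By additivity it suffices to treat a monomial, which [trunc] either keeps or kills. *)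
Lemma trunc_nneg S : in_nneg (trunc S).
Proof.
have [s /band_fun_sum ->] := band_opP S; elim: s => [|p s IHs].
  by rewrite big_nil trunc0 in_nneg0.
rewrite big_cons truncD; apply: in_nnegD => //; rewrite trunc_mono.
case: ifP => [p0|_]; last exact: in_nneg0.
exact: homog_nneg (mono_homog _ _).
Qed.

Lemma trunc_id S : in_nneg S -> trunc S = S.
Proof.
move=> SP; pattern S; apply: (nneg_sum_ind SP) => [|U T UE TE|k a k0].
- exact: trunc0.
- by rewrite truncD UE TE.
- by rewrite trunc_mono k0.
Qed.

(** Upper triangularity: [S] equals its truncation, which reads only the coordinates from [i]
    onwards. *)
Lemma nneg_local S v w i : in_nneg S ->
  (forall j, i <= j -> v j = w j) -> S v i = S w i.
Proof.
move=> /trunc_id <- vw /=; apply: band_ext => j.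
by have [/vw->//|_] := leP i j; rewrite !mul0r.
Qed.

(** * Diagonal entries and matrix units *)

Definition entry p S : K := S (delta p) p.

(** For upper triangular matrices the diagonal is multiplicative: on the coordinates from [p]
    onwards, column [p] of [T] is [entry p T] times the basis vector at [p]. *)
Lemma entryM p S T : in_nneg S -> in_nneg T ->
  entry p (S * T) = entry p S * entry p T.
Proof.
move=> SP TP; rewrite /entry bandME mulrC -band_opZ.
apply: nneg_local => // j; rewrite le_eqVlt => /predU1P[<-|pj].
  by rewrite /delta eqxx mulr1.
rewrite /delta gt_eqF // mulr0 -[RHS](mul0r (T (delta p) j)) -band_opZ.
apply: nneg_local => // l jl; rewrite /delta gt_eqF ?mul0r //.
exact: lt_le_trans jl.
Qed.

Definition munit (p q : int) : band := mono (q - p) (delta p).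

Lemma munitE p q v i : munit p q v i = delta p i * v q.
Proof.
rewrite /= /delta; have [->|_] := eqVneq i p; last by rewrite !mul0r.
by rewrite addrC subrK.
Qed.

Lemma munitM p q r : munit p q * munit q r = munit p r.
Proof.
by apply: bandP => v i; rewrite bandME !munitE /delta eqxx mul1r.
Qed.

Lemma munit_nneg p q : p <= q -> in_nneg (munit p q).
Proof. by move=> pq; apply: homog_nneg (mono_homog _ _); rewrite subr_ge0. Qed.

Lemma entry_munit p q r : entry r (munit p q) = ((r == p) && (q == r))%:R.
Proof.
by rewrite /entry munitE /delta; do 2!case: eqP => _; rewrite /= ?mulr1 ?mulr0.
Qed.

Lemma truncE S v i : trunc S v i = S (fun j => (i <= j)%R%:R * v j) i.
Proof. by []. Qed.

Lemma trunc_mull a S : trunc (mono 0 a * S) = mono 0 a * trunc S.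
Proof. by apply: bandP => v i; rewrite bandME /= addr0. Qed.

(** Degree 0 operators are diagonal and preserve degrees, so truncation is right linear over them;
    this makes the contracting homotopy linear over [R0]. *)
Lemma trunc_mulr a S : trunc (S * mono 0 a) = trunc S * mono 0 a.
Proof.
by apply: bandP => v i /=; apply: band_ext => j; rewrite addr0 mulrCA.
Qed.

Definition diag S : band := mono 0 (fun i => entry i S).

Lemma diagE S v i : diag S v i = entry i S * v i.
Proof. by rewrite /= addr0. Qed.

Lemma diagD S T : diag (S + T) = diag S + diag T.
Proof. by apply: bandP => v i; rewrite bandDE /= -mulrDl. Qed.

Lemma diag_mulr a S : diag (S * mono 0 a) = diag S * mono 0 a.
Proof.
apply: bandP => v i; rewrite bandME /= !addr0 mulrA; congr (_ * _).
rewrite mulrC -band_opZ; apply: band_ext => j; rewrite /= addr0 /delta.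
by case: eqP => [->|_]; rewrite ?mulr0.
Qed.

(** The product has row [q] of [S] as its only possibly nonzero row, placed at [p]. That row starts
    at column [q], beyond the diagonal. Hence [diag] annihilates the image of the differential. *)
Lemma diag_munit_mul p q S : p < q -> in_nneg S -> diag (munit p q * S) = 0.
Proof.
move=> pq SP; apply: bandP => v i; rewrite band0E diagE /entry bandME munitE /delta.
have [->|_] := eqVneq i p; last by rewrite !mul0r.
rewrite (@nneg_local S _ (fun=> 0 * 0)) // => [|j qj]; last first.
  by rewrite gt_eqF ?mulr0 //; apply: lt_le_trans qj.
by rewrite band_opZ mul0r mulr0 mul0r.
Qed.

(* The degree [0] part is what [trunc] loses after left multiplication by the
   element [munit (p + 1) p] of degree [-1]. *)
Lemma munit_trunc p S : in_nneg S -> munit p p * S = S ->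
  munit p (p + 1) * trunc (munit (p + 1) p * S) = S - munit p p * diag S.
Proof.
move=> SP <-; rewrite mulrA munitM; apply: bandP => v i.
rewrite bandDE bandNE !bandME !munitE diagE -mulrBr; congr (_ * _).
rewrite truncE bandME munitE /delta eqxx mul1r /entry bandME munitE /delta eqxx mul1r.
rewrite mulrC -band_opZ; apply/eqP; rewrite eq_sym subr_eq -band_opD; apply/eqP.
apply: nneg_local => // j; rewrite le_eqVlt => /predU1P[<-|pj].
  by rewrite /delta eqxx mulr1 gerDl ler10 mul0r add0r.
by rewrite /delta (gt_eqF pj) mulr0 addr0 lezD1 pj mul1r.
Qed.

(** * The two-term complex *)

Local Notation P := (nneg band_grading).
Local Notation R0 := (deg0 band_grading).

Definition idem n : band :=
  if n == 0 then munit 0 0 else if n == 1 then munit 1 1 else 0.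
Definition diff n : band := if n == 0 then munit 0 1 else 0.
(** Left multiplication by [munit 1 0] undoes the differential, but this element has degree -1 and
    lies outside [P]; only its truncated action will be used. *)
Definition codiff n : band := if n == 0 then munit 1 0 else 0.

Fact idem_nneg n : idem n \in nneg_pred band_grading.
Proof.
rewrite -/(in_nneg _) /idem.
by do 2?case: ifP => _; rewrite ?munit_nneg ?in_nneg0.
Qed.
Fact diff_nneg n : diff n \in nneg_pred band_grading.
Proof.
by rewrite -/(in_nneg _) /diff; case: ifP => _; rewrite ?munit_nneg ?in_nneg0.
Qed.
Definition idemP n : P := Nneg (idem_nneg n).
Definition diffP n : P := Nneg (diff_nneg n).

Lemma nneg_eq (x y : P) : nneg_val x = nneg_val y -> x = y.
Proof. exact: val_inj. Qed.

Lemma idem_mul n : idem n * idem n = idem n.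
Proof. by rewrite /idem; do 2?case: ifP => _; rewrite ?munitM ?mul0r. Qed.
Lemma idem_diff n : idem n * diff n = diff n.
Proof.
rewrite /diff; case: eqP => [->|_]; last by rewrite mulr0.
by rewrite /idem eqxx munitM.
Qed.
Lemma diff_diff n : diff n * diff (n + 1) = 0.
Proof. by rewrite /diff; case: eqP => [->|_]; rewrite ?mul0r // mulr0. Qed.
Lemma idem_codiff n : idem (n + 1) * codiff n = codiff n.
Proof.
rewrite /codiff; case: eqP => [->|_]; last by rewrite mulr0.
by rewrite /idem /= munitM.
Qed.

Lemma idemPM n : idemP n * idemP n = idemP n.
Proof. exact/nneg_eq/idem_mul. Qed.
Lemma idemP_diffP n : idemP n * diffP n = diffP n.
Proof. exact/nneg_eq/idem_diff. Qed.
Lemma diffP_diffP n : diffP n * diffP (n + 1) = 0.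
Proof. exact/nneg_eq/diff_diff. Qed.

Definition two_term_complex : complex P := ideal_complex idemP_diffP diffP_diffP.

Fact diag_deg0_subproof S : diag S \in deg0_pred band_grading.
Proof. exact: mono_homog. Qed.
Definition diag0 S : R0 := Deg0 (diag_deg0_subproof S).

Lemma deg0_eq (x y : R0) : deg0_val x = deg0_val y -> x = y.
Proof. exact: val_inj. Qed.

Lemma deg0_mono (x : R0) : exists a, deg0_val x = mono 0 a.
Proof. exact/asboolP/(valP x). Qed.

Lemma diag_mul_deg0 S (x : R0) : diag (S * deg0_val x) = diag S * deg0_val x.
Proof. by have [a ->] := deg0_mono x; apply: diag_mulr. Qed.
Lemma trunc_mul_deg0 S (x : R0) : trunc (S * deg0_val x) = trunc S * deg0_val x.
Proof. by have [a ->] := deg0_mono x; apply: trunc_mulr. Qed.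

(** * Domination over the degree 0 subring *)

Local Notation phi := (@deg0_incl band band_grading).
Local Notation C0 := (restr_complex phi two_term_complex).
Local Notation Cn n := (restr phi (two_term_complex n)).

Definition cval n (x : Cn n) : band := nneg_val (ideal_val x).

Lemma cval_inj n (x y : Cn n) : cval x = cval y -> x = y.
Proof. by move=> xy; apply/ideal_eq/nneg_eq. Qed.
Lemma cvalD n (x y : Cn n) : cval (x + y) = cval x + cval y.
Proof. by []. Qed.
Lemma cvalN n (x : Cn n) : cval (- x) = - cval x.
Proof. by []. Qed.
Lemma cval0 n : cval (0 : Cn n) = 0.
Proof. by []. Qed.
Lemma cvalZ n (a : R0^c) (x : Cn n) : cval (a *: x) = cval x * deg0_val a.
Proof. by []. Qed.
Lemma cval_nneg n (x : Cn n) : in_nneg (cval x).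
Proof. exact: valP (ideal_val x). Qed.
Lemma idem_cval n (x : Cn n) : idem n * cval x = cval x.
Proof. by have /(congr1 (@nneg_val _ _)) := idealP x. Qed.
Lemma cval_diff n (x : Cn (n + 1)) : cval (ch_d C0 n x) = diff n * cval x.
Proof. by []. Qed.

Definition dom_rank n : nat := n == 0.

Definition dominating_complex : complex R0 :=
  @Complex R0 (fun n => 'rV[R0^c]_(dom_rank n)) (fun n => \0) (fun _ _ => erefl).

(** The constant row treats both ranks at once: the diagonal part in degree 0, and the only map to
    the zero module elsewhere. *)
Definition dom_in n (x : Cn n) : 'rV[R0^c]_(dom_rank n) :=
  const_mx (diag0 (cval x)).

Lemma dom_in_linear n : linear (@dom_in n).
Proof.
move=> a x y; apply/rowP => i; rewrite !mxE; apply: deg0_eq.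
rewrite -[LHS]/(diag (cval (a *: x + y))) cvalD cvalZ diagD diag_mul_deg0.
by [].
Qed.
HB.instance Definition _ n :=
  GRing.isLinear.Build R0^c _ _ _ (@dom_in n) (@dom_in_linear n).

(** Reads off the single coordinate in rank 1 and gives 0 in rank 0, which avoids casting along
    [dom_rank n]. *)
Definition row_total (n : nat) (y : 'rV[R0^c]_n) : R0 := \sum_i (y 0 i : R0).

Definition dom_out n (y : 'rV[R0^c]_(dom_rank n)) : Cn n :=
  ideal_out (idemPM n) (const_mx (phi (row_total y) : P^c)).

Lemma cval_dom_out n (y : 'rV[R0^c]_(dom_rank n)) :
  cval (dom_out y) = idem n * deg0_val (row_total y).
Proof. by rewrite /cval /= mxE. Qed.

Lemma row_totalP (n : nat) (a : R0^c) (x y : 'rV[R0^c]_n) :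
  row_total (a *: x + y) = row_total x * (a : R0) + row_total y.
Proof.
rewrite /row_total mulr_suml -big_split; apply: eq_bigr => i _.
by rewrite !mxE.
Qed.

Lemma row_total0 (n : nat) (y : 'rV[R0^c]_n) : n = 0%N -> row_total y = 0.
Proof. by move=> n0; move: y; rewrite n0 => y; rewrite /row_total big_ord0. Qed.

Lemma dom_out_linear n : linear (@dom_out n).
Proof.
move=> a x y; apply: cval_inj.
rewrite cvalD cvalZ !cval_dom_out row_totalP.
by rewrite -[deg0_val (_ + _)]/(deg0_val _ * deg0_val a + deg0_val _) mulrDr mulrA.
Qed.
HB.instance Definition _ n :=
  GRing.isLinear.Build R0^c _ _ _ (@dom_out n) (@dom_out_linear n).

Lemma dom_in_comm n (x : Cn (n + 1)) :
  dom_in (ch_d C0 n x) = ch_d dominating_complex n (dom_in x).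
Proof.
apply/rowP => i; rewrite !mxE; apply: deg0_eq.
rewrite -[LHS]/(diag _) cval_diff -[RHS]/(0 : band) /diff; case: eqP => _.
  exact: diag_munit_mul (cval_nneg x).
by rewrite mul0r; apply: bandP => v j; rewrite diagE mul0r.
Qed.

Lemma dom_out_comm n (y : 'rV[R0^c]_(dom_rank (n + 1))) :
  dom_out (ch_d dominating_complex n y) = ch_d C0 n (dom_out y).
Proof.
rewrite (_ : ch_d _ _ _ = 0) // raddf0; apply: cval_inj.
rewrite cval_diff cval0 cval_dom_out /diff; case: eqP => [n0|_].
  by rewrite row_total0 ?mulr0 // /dom_rank n0.
by rewrite mul0r.
Qed.

Definition dom_in_map : chain_map C0 dominating_complex :=
  @ChainMap _ C0 dominating_complex (fun n => @dom_in n) dom_in_comm.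
Definition dom_out_map : chain_map dominating_complex C0 :=
  @ChainMap _ dominating_complex C0 (fun n => @dom_out n) dom_out_comm.

(** Truncation brings the product back into [P], at the price of linearity over [R0] only. The sign
    matches the convention of composite minus identity. *)
Definition dom_htpy_val n (x : Cn n) : P :=
  Nneg (trunc_nneg (- (codiff n * cval x))).

Fact dom_htpy_subproof n (x : Cn n) :
  dom_htpy_val x \in ideal_pred (idemP (n + 1)).
Proof.
apply/eqP/nneg_eq; rewrite -[LHS]/(idem _ * trunc _) -[RHS]/(trunc _).
(* Each [idem] is diagonal, hence passes through [trunc]. *)
have [a ia] : exists a, idem (n + 1) = mono 0 a.
  rewrite /idem; do 2?case: ifP => _; rewrite ?/munit ?subrr; try by eexists.
  by exists (fun=> 0); apply: bandP => v i; rewrite /= mul0r.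
by rewrite ia -trunc_mull -ia mulrN mulrA idem_codiff.
Qed.
Definition dom_htpy n (x : Cn n) : Cn (n + 1) := Ideal (dom_htpy_subproof x).

Lemma cval_dom_htpy n (x : Cn n) : cval (dom_htpy x) = trunc (- (codiff n * cval x)).
Proof. by []. Qed.

Lemma dom_htpy_linear n : linear (@dom_htpy n).
Proof.
move=> a x y; apply: cval_inj.
rewrite cvalD cvalZ !cval_dom_htpy cvalD cvalZ -trunc_mul_deg0 -truncD.
by rewrite mulrDr mulrA opprD mulNr.
Qed.
HB.instance Definition _ n :=
  GRing.isLinear.Build R0^c _ _ _ (@dom_htpy n) (@dom_htpy_linear n).

Lemma truncN S : trunc (- S) = - trunc S.
Proof. exact: bandP. Qed.

Lemma dom_retract : comp_homotopic_id dom_in_map dom_out_map.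
Proof.
exists (fun n => @dom_htpy n) => n x; apply: cval_inj.
rewrite !cvalD cvalN.
rewrite -[cval (dom_out_map _ _)]/(cval (dom_out (dom_in x))) cval_dom_out.
rewrite cval_diff !cval_dom_htpy cval_diff !truncN mulrN mulrA.
have dE : deg0_val (row_total (dom_in x)) = if n + 1 == 0 then diag (cval x) else 0.
  rewrite /row_total /dom_in /dom_rank; case: eqP => _.
    by rewrite big_ord1 mxE.
  by rewrite big_ord0.
rewrite dE /diff /codiff.
(* In degree 0 only the term [d h] survives, and [munit_trunc] shows that it removes everything but
   the diagonal part. *)
have [n10|n10] := eqVneq (n + 1) 0.
  have -> : (n == 0) = false by apply/eqP => n0; rewrite n0 in n10.
  have iE : idem (n + 1) = munit 0 0 by rewrite /idem n10.
  have xE := idem_cval x; rewrite iE in xE *.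
  rewrite !mul0r trunc0 oppr0 addr0.
  by rewrite (munit_trunc (cval_nneg x) xE) opprB.
(* In degree 1 the composite through the dominating complex is 0, and [h d] is minus the identity
   because [munit 1 0 * munit 0 1 = munit 1 1]. *)
rewrite mulr0 mul0r oppr0 !add0r; have [n0|n0] := eqVneq n 0.
  have iE : idem (n + 1) = munit 1 1 by rewrite n0.
  have xE := idem_cval x; rewrite munitM -iE xE.
  by rewrite trunc_id // cval_nneg.
have iE : idem (n + 1) = 0.
  by rewrite /idem (negPf n10) -subr_eq0 addrK (negPf n0).
have := idem_cval x; rewrite iE mul0r => <-; by rewrite !mul0r trunc0.
Qed.

Lemma two_term_finitely_dominated : finitely_dominated C0.
Proof.
exists dominating_complex; split.
- exists 0, 0 => n n0; have -> : dominating_complex n = 'rV[R0^c]_0 :> rmodType R0.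
    by rewrite /= /dom_rank; case: eqP n0 => [->|].
  by move=> x; apply/rowP => -[].
- by move=> n; exists (dom_rank n), idfun; exists id.
- by exists dom_in_map, dom_out_map; apply: dom_retract.
Qed.

Lemma two_term_trivial n : n != 0 -> n != 1 -> forall x : two_term_complex n, x = 0.
Proof.
move=> n0 n1 x; apply: (@cval_inj n x 0).
by rewrite -(@idem_cval n x) /idem (negPf n0) (negPf n1) mul0r.
Qed.

Lemma two_term_bounded : bounded two_term_complex.
Proof.
exists 0, 1 => n n01; apply: two_term_trivial; apply/eqP => n_eq;
  by rewrite n_eq in n01.
Qed.

Lemma two_term_fg_projective n : fg_projective (two_term_complex n).
Proof. exact: free_retract_fg_projective (ideal_retract (idemPM n)). Qed.

(** * The Euler characteristic as an obstruction to freeness *)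

Definition entry_nneg (p : int) (x : P) : K := entry p (nneg_val x).

Lemma entry_nneg_is_zmod p : zmod_morphism (entry_nneg p).
Proof. by []. Qed.

Lemma entry_nneg_is_monoid p : monoid_morphism (entry_nneg p).
Proof.
split; last by move=> x y; apply: entryM; [exact: valP x | exact: valP y].
by rewrite /entry_nneg /entry /= /delta addr0 eqxx mulr1.
Qed.

HB.instance Definition _ p :=
  GRing.isZmodMorphism.Build P K (entry_nneg p) (entry_nneg_is_zmod p).
HB.instance Definition _ p :=
  GRing.isMonoidMorphism.Build P K (entry_nneg p) (entry_nneg_is_monoid p).

Lemma two_term_not_free : ~ exists D : complex P,
  [/\ bounded D, forall n : int, fg_free (D n)
    & homotopy_equivalent two_term_complex D].
Proof.
case=> D [[a [b D0]] Dfree CD].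
pose c n := projT1 (cid (fg_free_retract (Dfree n))).
have cE n p : fr_trace (entry_nneg p) (c n) id = (rk (c n))%:R.
  exact: projT2 (cid (fg_free_retract (Dfree n))) _ _.
(* Large enough that degrees [- m] and [m] lie outside the supports of both complexes. *)
pose m := (`|a| + `|b| + 2)%N.
have euler p : \sum_(k < m + m)
    (-1) ^+ k * entry p (idem (- m%:Z + k%:Z + 1)) =
    \sum_(k < m + m) (-1) ^+ k * (rk (c (- m%:Z + k%:Z + 1)))%:R :> K.
  have mm : - m%:Z + (m + m)%N%:Z = m%:Z by lia.
  under [RHS]eq_bigr do rewrite -(cE _ p).
  rewrite -(@euler_homotopy_equivalent _ _ (entry_nneg p) two_term_complex _
    (fun n => ideal_retract (idemPM n)) c _ _ CD).
  - by apply: eq_bigr => k _; rewrite trace_ideal.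
  - by apply: two_term_trivial; lia.
  - by apply: D0; lia.
  - by rewrite mm; apply: two_term_trivial; lia.
  - by rewrite mm; apply: D0; lia.
(* Both idempotents vanish at the entry 2. The entry 1 would only give the opposite sign, which is
   no contradiction in characteristic 2. *)
have := euler 0; rewrite -(euler 2) => {euler}.
rewrite [RHS]big1 => [|k _]; last first.
  by rewrite /idem; do 2?case: ifP => _; rewrite ?entry_munit /entry ?mulr0.
(* At the entry 0 only degree 0 contributes, which is the index [m - 1] because of the shift by one.
   The surviving sign is nonzero in [K]. *)
have m1 : (m.-1 < m + m)%N by lia.
rewrite (bigD1 (Ordinal m1)) //= big1 => [|k /eqP km].
  rewrite (_ : _ + 1 = 0); last by lia.
  by rewrite /idem entry_munit mulr1 addr0; apply/eqP; rewrite signr_eq0.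
rewrite /idem ifF; last by apply/eqP => k0; apply: km; apply: val_inj => /=; lia.
by case: ifP => _; rewrite ?entry_munit /entry /= ?mulr0.
Qed.

End BandOperators.

Theorem mainTheorem5 :
  exists (R : pzRingType) (G : zgrading R),
    strongly_graded G /\
    exists C : complex (nneg G),
      [/\ bounded C,
          forall n : int, fg_projective (C n),
          finitely_dominated (restr_complex (@deg0_incl R G) C)
        & ~ exists D : complex (nneg G),
              [/\ bounded D,
                  forall n : int, fg_free (D n)
                & homotopy_equivalent C D]].
Proof.
(* Any nonzero commutative coefficient ring would serve. *)
exists (band int), (band_grading int); split; first exact: band_strongly_graded.
exists (two_term_complex int); split.
- exact: two_term_bounded.
- exact: two_term_fg_projective.
- exact: two_term_finitely_dominated.
- exact: two_term_not_free.
Qed.
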